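(* Let $P$ be a set of odd primes, let $p\in P$ be arbitrary, and let $\mathcal{M}\subset\mathcal{G}$ be an $A_P$-submodule spanned by simple $D_{2n}$-modules with $n$ odd, such that for each fixed $n$ either all simple $D_{2n}$-modules or none belong to $\mathcal{M}$. Then the center of $A_{P,\mathcal{M}}$ is generated (as a unital algebra) by $1$ and $\mathrm{Res}_p\mathrm{Ind}_p$.
   Context: All vector spaces are over $\mathbb{C}$; modules are left modules and finite-dimensional. For an integer $n\ge 3$ let $D_{2n}=\langle r_n,s_n\mid r_n^n=1,\ s_n^2=1,\ s_nr_ns_n=r_n^{-1}\rangle$ be the dihedral group of order $2n$ (dihedral groups are left undefined for $n=1,2$). For a prime $p$, $D_{2n}$ is embedded in $D_{2pn}$ by $r_n\mapsto r_{pn}^p$, $s_n\mapsto s_{pn}$. Let $\mathcal{G}$ be the complexified Grothendieck group of $\bigoplus_{n\ge 3}D_{2n}\text{-mod}$, i.e. the complex vector space with basis the isomorphism classes of simple $D_{2n}$-modules, $n\ge 3$; a module is identified with its class in $\mathcal{G}$. Linear endomorphisms $\mathrm{Ind}_p,\mathrm{Res}_p$ of $\mathcal{G}$ are defined as follows: $\mathrm{Ind}_p$ sends a $D_{2n}$-module to the $D_{2pn}$-module induced from it along the embedding above; $\mathrm{Res}_p$ sends a $D_{2n}$-module to its restriction to $D_{2n/p}$ if $p\mid n$ and $n/p\ge 3$, and to $0$ otherwise. For a set $P$ of primes, $A_P$ is the free unital associative $\mathbb{C}$-algebra on the symbols $\mathrm{Res}_p,\mathrm{Ind}_p$ ($p\in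 P$), acting on $\mathcal{G}$ by these operators. For an $A_P$-submodule $\mathcal{M}\subset\mathcal{G}$, $\mathrm{Ann}_{A_P}(\mathcal{M})$ is the ideal of elements annihilating every element of $\mathcal{M}$, and $A_{P,\mathcal{M}}=A_P/\mathrm{Ann}_{A_P}(\mathcal{M})$; the symbols $\mathrm{Res}_p,\mathrm{Ind}_p$ also denote their images in $A_{P,\mathcal{M}}$. *)

(* Defs.v *)
From HB Require Import structures.
From mathcomp Require Import all_boot all_order all_fingroup all_algebra.
From mathcomp Require Import all_solvable mxrepresentation.
From mathcomp Require Import generic_quotient ring_quotient.
From mathcomp Require Import boolp classical_sets reals complex.
From mathcomp Require Import finmap monalg.

Set Implicit Arguments.
Unset Strict Implicit.
Unset Printing Implicit Defensive.

Import GRing.Theory.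

Local Open Scope ring_scope.

(* [Dih a b : dihedral n] is r_n ^ a * s_n ^ b.  This is the group of order 2n
   only for n >= 2, since 'Z_n is Z/nZ only for n >= 2. *)
Record dihedral (n : nat) : predArgType := Dih { dih_rot : 'Z_n; dih_refl : bool }.

Section DihedralGroup.
Variable n : nat.
Implicit Types x y z : dihedral n.

Definition dih_pair x := (dih_rot x, dih_refl x).
Definition pair_dih (u : 'Z_n * bool) : dihedral n := Dih u.1 u.2.

Lemma dih_pairK : cancel dih_pair pair_dih. Proof. by case. Qed.

HB.instance Definition _ := Finite.copy (dihedral n) (can_type dih_pairK).

Definition dih_mul x y : dihedral n :=
  Dih (dih_rot x + (if dih_refl x then - dih_rot y else dih_rot y)) (dih_refl x (+) dih_refl y).
Definition dih_one : dihedral n := Dih 0 false.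
Definition dih_inv x : dihedral n :=
  Dih (if dih_refl x then dih_rot x else - dih_rot x) (dih_refl x).

Lemma dih_mulA : associative dih_mul.
Proof.
move=> [a []] [b []] [c []]; rewrite /dih_mul /=; congr Dih;
  by rewrite ?opprD ?opprK ?addrA.
Qed.

Lemma dih_mul1 : left_id dih_one dih_mul.
Proof. by case=> a b; rewrite /dih_mul /= add0r. Qed.

Lemma dih_mulV : left_inverse dih_one dih_inv dih_mul.
Proof.
by case=> a []; rewrite /dih_mul /= /dih_one ?subrr ?addNr.
Qed.

HB.instance Definition _ :=
  Finite_isGroup.Build (dihedral n) dih_mulA dih_mul1 dih_mulV.

Definition dih_r : dihedral n := Dih 1 false.
Definition dih_s : dihedral n := Dih 0 true.

Lemma dih_rX k : (dih_r ^+ k)%g = Dih k%:R false.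
Proof.
elim: k => [|k IHk]; first by rewrite expg0.
by rewrite expgS IHk mulrS.
Qed.

Lemma dih_rXs k (b : bool) : (dih_r ^+ k * dih_s ^+ b)%g = Dih k%:R b.
Proof.
rewrite dih_rX; case: b; rewrite ?expg1 ?expg0 ?mulg1 //.
by congr Dih; rewrite addr0.
Qed.

Lemma dih_rXn : (1 < n)%N -> (dih_r ^+ n = 1)%g.
Proof. by move=> n_gt1; rewrite dih_rX pchar_Zp. Qed.

Lemma dih_sX2 : (dih_s ^+ 2 = 1)%g.
Proof. by rewrite expgS expg1; congr Dih; rewrite /= subr0. Qed.

Lemma dih_srs : (dih_s * dih_r * dih_s = dih_r^-1)%g.
Proof. by congr Dih; rewrite /= ?subr0 ?add0r. Qed.

Lemma card_dih : (1 < n)%N -> #|[set: dihedral n]| = (n.*2)%N.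
Proof.
move=> n_gt1; rewrite cardsT (bij_eq_card (Bijective dih_pairK _)); last by case.
by rewrite card_prod card_ord card_bool Zp_cast // muln2.
Qed.

(* [dihedral n] is thus the group presented by r^n = s^2 = 1, s r s = r^-1. *)
Lemma dih_isog : (1 < n)%N -> ([set: dihedral n] \isog 'D_n.*2)%g.
Proof.
move=> n_gt1; rewrite isogEcard card_dih // card_dihedral // leqnn andbT.
rewrite (Grp_dihedral n_gt1); apply/existsP; exists (dih_r, dih_s) => /=.
rewrite !xpair_eqE dih_rXn // dih_sX2 !eqxx /=; apply/andP; split; last first.
  by rewrite conjgE -[(dih_s^-1)%g]/dih_s mulgA dih_srs.
apply/eqP/setP=> -[a b]; rewrite inE.
have := dih_rXs a b; rewrite natr_Zp => <-.
by rewrite groupM // mem_gen // inE ?mem_cycle ?orbT.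
Qed.

End DihedralGroup.

Arguments dih_r {n}.
Arguments dih_s {n}.

Record level : predArgType := Level { level_val :> nat; _ : (2 < level_val)%N }.
HB.instance Definition _ := [isSub for level_val].
HB.instance Definition _ := [Choice of level by <:].

Record prime_nat : predArgType :=
  PrimeNat { prime_val :> nat; _ : prime prime_val }.
HB.instance Definition _ := [isSub for prime_val].
HB.instance Definition _ := [Choice of prime_nat by <:].

Lemma level_gt1 (n : level) : (1 < n)%N.
Proof. by case: n => n /= /ltnW. Qed.

Lemma level_gt2 (n : level) : (2 < n)%N. Proof. exact: valP n. Qed.

Lemma prime_natP (p : prime_nat) : prime p. Proof. exact: valP p. Qed.

Section Embedding.
Variables (p : nat) (m n : level).

(* r_m ^ i * s_m ^ b |-> (r_n ^ p) ^ i * s_n ^ b *)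
Definition dih_emb (x : dihedral m) : dihedral n :=
  ((dih_r ^+ p) ^+ dih_rot x * dih_s ^+ dih_refl x)%g.

Hypothesis def_n : n = (p * m)%N :> nat.

Lemma dih_embE x : dih_emb x = Dih (p * dih_rot x)%:R (dih_refl x).
Proof. by rewrite /dih_emb -expgM dih_rXs. Qed.

Let emb_rot (a : 'Z_m) : 'Z_n := (p * a)%:R.

Let emb_rotD a b : emb_rot (a + b) = emb_rot a + emb_rot b.
Proof.
have modE k l : k = l %[mod n] -> k%:R = l%:R :> 'Z_n.
  by move=> eq_kl; rewrite -[LHS]Zp_nat_mod ?eq_kl ?Zp_nat_mod ?level_gt1.
rewrite /emb_rot -natrD -mulnDr; apply: modE.
have -> : (a + b)%R = ((a + b)%N %% m)%N :> nat.
  by congr (_ %% _)%N; apply/Zp_cast/level_gt1.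
by rewrite muln_modr -def_n modn_mod.
Qed.

Let emb_rotN a : emb_rot (- a) = - emb_rot a.
Proof.
apply/eqP; rewrite -addr_eq0 -emb_rotD addNr /emb_rot /= muln0; exact/eqP.
Qed.

Lemma dih_emb_morphM : {in [set: dihedral m] &, {morph dih_emb : x y / (x * y)%g}}.
Proof.
move=> [a b] [c d] _ _; rewrite !dih_embE /=; congr Dih => /=.
apply: etrans (emb_rotD a (if b then - c else c)) _.
by case: b; rewrite ?emb_rotN.
Qed.

Definition dih_emb_morphism := Morphism dih_emb_morphM.

Lemma injm_dih_emb : ('injm dih_emb_morphism)%g.
Proof.
have p_gt0 : (0 < p)%N.
  by move: (level_gt1 n); rewrite def_n lt0n; apply: contraTneq => ->.
apply/injmP => -[a b] [c d] _ _; rewrite /= !dih_embE => -[eq_ac ->].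
congr Dih; apply/val_inj/eqP; rewrite -(eqn_pmul2l p_gt0).
have/(congr1 val) := eq_ac.
have valE (u : 'Z_m) : val ((p * u)%:R : 'Z_n) = (p * u)%N.
  rewrite /= val_Zp_nat ?level_gt1 // modn_small // def_n ltn_pmul2l //.
  by rewrite -[X in (_ < X)%N](Zp_cast (level_gt1 m)).
by rewrite !valE => ->.
Qed.

End Embedding.

Section InducedRepresentation.
Variables (F : fieldType) (gT : finGroupType) (G H : {group gT}).
Variables (m : nat) (rH : mx_representation F H m).

Local Notation index := #|lcosets H G|.

Definition coset_rep (i : 'I_index) : gT := fingroup.repr (enum_val i).

(* The matrix of g on F[G] (x)_F[H] V, the direct sum of the t_i (x) V with t_i
   running through the left transversal [coset_rep]: the (i, j) block comes from
   g (t_j (x) v) = t_i (x) (t_i^-1 g t_j) v when t_i^-1 g t_j is in H.  Left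
   modules are read off from the action of representations on column vectors. *)
Definition ind_mx (g : gT) : 'M[F]_(\sum_(i < index) m) :=
  \mxblock_(i < index, j < index)
    (let h := ((coset_rep i)^-1 * g * coset_rep j)%g in
     if h \in H then rH h else 0).

Hypothesis sHG : H \subset G.

Lemma ind_mx_repr : mx_repr G ind_mx.
Proof.
have coset_repP (i : 'I_index) : exists2 x, x \in G & enum_val i = (x *: H)%g.
  exact/lcosetsP/enum_valP.
have coset_repH (i : 'I_index) : enum_val i = (coset_rep i *: H)%g.
  have [x _ defi] := coset_repP i; rewrite [LHS]defi; apply/esym/lcoset_eqP.
  by rewrite /coset_rep defi; apply: mem_repr (lcoset_refl _ _).
have coset_repG i : coset_rep i \in G.
  have [x Gx defi] := coset_repP i; rewrite /coset_rep defi.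
  have /lcosetP[h Hh ->] := mem_repr x (lcoset_refl H x).
  by rewrite groupM // (fintype.subsetP sHG).
have eq_rep i j : ((coset_rep i)^-1 * coset_rep j \in H)%g = (i == j).
  apply/idP/eqP => [|->]; last by rewrite mulVg group1.
  rewrite -mem_lcoset => /lcoset_eqP eqij; apply: enum_val_inj.
  by rewrite !coset_repH eqij.
split=> [|g h Gg Gh].
  rewrite -(mxdiagZ (p_ := fun _ : 'I_index => m)) /mxdiag.
  apply: eq_mxblock => i j /=; rewrite mulg1 eq_rep conform_mx_id.
  by case: eqP => // ->; rewrite mulVg repr_mx1.
rewrite /ind_mx mul_mxblock; apply: eq_mxblock => i k.
have Ghk : (h * coset_rep k)%g \in G by rewrite groupM.
have [j defj] : exists j : 'I_index, enum_val j = (h * coset_rep k *: H)%g.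
  have lHG : (h * coset_rep k *: H)%g \in lcosets H G.
    by apply/lcosetsP; exists (h * coset_rep k)%g.
  by exists (enum_rank_in lHG (h * coset_rep k *: H)%g); rewrite enum_rankK_in.
have inH l : ((coset_rep l)^-1 * h * coset_rep k \in H)%g = (l == j).
  rewrite -mulgA -mem_lcoset; apply/lcoset_eqP/eqP => [eq_l|->].
    by apply: enum_val_inj; rewrite defj eq_l -coset_repH.
  by rewrite -coset_repH defj.
rewrite (bigD1 j) //= big1 ?addr0 => [|l /negPf ne_lj]; last first.
  by rewrite inH ne_lj mulmx0.
rewrite inH eqxx.
have Hj : ((coset_rep j)^-1 * h * coset_rep k \in H)%g by rewrite inH.
have -> : ((coset_rep i)^-1 * (g * h) * coset_rep k =
  ((coset_rep i)^-1 * g * coset_rep j) * ((coset_rep j)^-1 * h * coset_rep k))%g.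
  by rewrite !mulgA mulgK.
rewrite groupMr //; case: ifP => Hi; last by rewrite mul0mx.
by rewrite repr_mxM.
Qed.

Definition ind_repr := MxRepresentation ind_mx_repr.

End InducedRepresentation.

Section DihedralModules.
Variable F : fieldType.
Variables (p : nat) (m n : level) (def_n : n = (p * m)%N :> nat).

Local Notation emb := (dih_emb_morphism def_n).

Lemma emb_preim : (emb @*^-1 [set: dihedral n] == [set: dihedral m] :> {set _})%g.
Proof. by apply/eqP/setP=> x; rewrite !inE. Qed.

Definition dih_res d (rG : mx_representation F [set: dihedral n] d) :
    mx_representation F [set: dihedral m] d :=
  eqg_repr (morphpre_repr emb rG) emb_preim.

Local Notation invemb := (invm_morphism (injm_dih_emb def_n)).

Lemma invemb_preim :
  (invemb @*^-1 [set: dihedral m])%g == (emb @* [set: dihedral m])%g :> {set _}.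
Proof. by apply/eqP/setP=> x; rewrite !inE andbT. Qed.

Definition dih_ind d (rG : mx_representation F [set: dihedral m] d) :=
  ind_repr (eqg_repr (morphpre_repr invemb rG) invemb_preim)
           (finset.subsetT (emb @* [set: dihedral m])%g) :
  mx_representation F [set: dihedral n] _.

End DihedralModules.

Lemma mul_level_gt2 (p : prime_nat) (n : level) : (2 < p * n)%N.
Proof.
by apply: leq_trans (level_gt2 n) _; rewrite leq_pmull // prime_gt0 // prime_natP.
Qed.

Definition mul_level (p : prime_nat) (n : level) : level :=
  Level (mul_level_gt2 p n).

Section GrothendieckGroup.
Variable R : realType.
Local Notation C := R[i].

(* The index type of the irreducible representations of D_2n up to similarity. *)
Definition simples (n : level) : irrType C [set: dihedral n] :=
  DecSocleType (regular_repr C [set: dihedral n]).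

Definition simple_module : choiceType := {n : level & simples n}.

Definition groth : lmodType C := {malg C[simple_module]}.

Definition simple_class (S : simple_module) : groth := << S >>.

(* The module is the direct sum of its isotypic components W, each of them being
   the sum of [socle_mult W] copies of the simple module [socle_repr W]. *)
Definition mod_class (n : level) d (rG : mx_representation C [set: dihedral n] d) :
    groth :=
  \sum_(W : DecSocleType rG)
     (socle_mult W)%:R *:
       simple_class (Tagged simples (irr_comp (simples n) (socle_repr W))).

Definition lin_ext (K : choiceType) (V : lmodType C) (f : K -> V)
    (x : {malg C[K]}) : V :=
  \sum_(k <- msupp x) x@_k *: f k.

Definition Ind (p : prime_nat) : groth -> groth :=
  lin_ext (fun S : simple_module =>
    mod_class (dih_ind (erefl : mul_level p (tag S) = (p * tag S)%N :> nat)
                       (irr_repr (tagged S)))).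

Lemma res_level_proof (p : prime_nat) (n : level) (n_gt2 : (2 < n %/ p)%N) :
  (p %| n)%N -> n = (p * Level n_gt2)%N :> nat.
Proof. by move=> p_dv_n; rewrite /= mulnC divnK. Qed.

Definition Res (p : prime_nat) : groth -> groth :=
  lin_ext (fun S : simple_module =>
    let n := tag S in
    match @idP (p %| n)%N, @idP (2 < n %/ p)%N with
    | ReflectT p_dv_n, ReflectT n_gt2 =>
        mod_class (dih_res (res_level_proof n_gt2 p_dv_n) (irr_repr (tagged S)))
    | _, _ => 0
    end).

Lemma lin_extEw (K : choiceType) (V : lmodType C) (f : K -> V) (d : {fset K})
    (x : {malg C[K]}) :
  (msupp x `<=` d)%fset -> lin_ext f x = \sum_(k <- d) x@_k *: f k.
Proof.
move=> le_xd; rewrite /lin_ext (big_fset_incl _ le_xd) // => k _ /mcoeff_outdom ->.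
by rewrite scale0r.
Qed.

Lemma lin_ext_is_linear (K : choiceType) (V : lmodType C) (f : K -> V) :
  linear (lin_ext f).
Proof.
move=> c x y; pose d := (msupp x `|` msupp y)%fset.
have le_x : (msupp x `<=` d)%fset := fsubsetUl _ _.
have le_y : (msupp y `<=` d)%fset := fsubsetUr _ _.
have le_xy : (msupp (c *: x + y) `<=` d)%fset.
  by apply: fsubset_trans (msuppD_le _ _) _; rewrite fsetSU // msuppZ_le.
rewrite !(lin_extEw f (d := d)) // scaler_sumr -big_split /=.
by apply: eq_bigr => k _; rewrite mcoeffD mcoeffZ scalerDl scalerA.
Qed.

HB.instance Definition _ (K : choiceType) (V : lmodType C) (f : K -> V) :=
  GRing.isLinear.Build C {malg C[K]} V *:%R (lin_ext f) (lin_ext_is_linear f).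

HB.instance Definition _ (p : prime_nat) := GRing.Linear.on (Ind p).
HB.instance Definition _ (p : prime_nat) := GRing.Linear.on (Res p).

End GrothendieckGroup.

Definition lin_span (R : realType) (X : set (groth R)) : set (groth R) :=
  smallest (fun S : set (groth R) => GRing.submod_closed [in S]) X.

Variant op_sym (P : set prime_nat) : predArgType := GRes of P | GInd of P.

Section OpSymChoice.
Variable P : set prime_nat.
Definition sym_sum (g : op_sym P) : P + P :=
  match g with GRes p => inl p | GInd p => inr p end.
Definition sum_sym (u : P + P) : op_sym P :=
  match u with inl p => GRes p | inr p => GInd p end.
Lemma sym_sumK : cancel sym_sum sum_sym. Proof. by case. Qed.
HB.instance Definition _ := Choice.copy (op_sym P) (can_type sym_sumK).
End OpSymChoice.

Section OperatorAlgebra.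
Variables (R : realType) (P : set prime_nat).
Local Notation C := R[i].
Local Notation G := (groth R).

Definition opalg : lalgType C := {malg C[{fmonom op_sym P}]}.

Definition symRes (p : P) : opalg := << fmu (GRes p) >>.
Definition symInd (p : P) : opalg := << fmu (GInd p) >>.

Definition sym_op (g : op_sym P) : G -> G :=
  match g with GRes p => @Res R (val p) | GInd p => @Ind R (val p) end.

(* The word g_1 ... g_k acts as the composite g_1 \o ... \o g_k. *)
Definition word_op (w : seq (op_sym P)) (v : G) : G := foldr sym_op v w.

Definition op_act (a : opalg) (v : G) : G :=
  lin_ext (fun w : {fmonom op_sym P} => word_op w v) a.

Lemma sym_op_is_linear g : linear (sym_op g).
Proof. by case: g => p c u v; rewrite /= linearP. Qed.

Lemma word_op_is_linear w : linear (word_op w).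
Proof. by elim: w => [|g w IHw] c u v //=; rewrite IHw sym_op_is_linear. Qed.

HB.instance Definition _ w :=
  GRing.isLinear.Build C G G *:%R (word_op w) (word_op_is_linear w).

Lemma op_act_is_linear a : linear (op_act a).
Proof.
move=> c u v; rewrite /op_act /lin_ext scaler_sumr -big_split /=.
by apply: eq_bigr => w _; rewrite linearP scalerDr !scalerA mulrC.
Qed.

HB.instance Definition _ a :=
  GRing.isLinear.Build C G G *:%R (op_act a) (op_act_is_linear a).

Lemma op_act_linearl v c a b : op_act (c *: a + b) v = c *: op_act a v + op_act b v.
Proof. by rewrite /op_act linearP. Qed.

Lemma op_actBl a b v : op_act (a - b) v = op_act a v - op_act b v.
Proof. exact: (raddfB (lin_ext (fun w : {fmonom op_sym P} => word_op w v))). Qed.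

Lemma op_act0l v : op_act 0 v = 0.
Proof. by rewrite -(subrr 0) op_actBl subrr. Qed.

Lemma op_actU c w v : op_act << c *g w >> v = c *: word_op w v.
Proof. by rewrite /op_act (lin_extEw _ msuppU_le) big_seq_fset1 mcoeffUU. Qed.

Lemma op_act1 v : op_act 1 v = v.
Proof. by rewrite -[X in op_act X]/<< 1 *g mone >> op_actU scale1r fm1. Qed.

Lemma op_actM a b v : op_act (a * b) v = op_act a (op_act b v).
Proof.
have op_act_suml I (r : seq I) (F : I -> opalg) :
    op_act (\sum_(i <- r) F i) v = \sum_(i <- r) op_act (F i) v.
  by rewrite /op_act linear_sum.
rewrite malgME op_act_suml [in RHS]/op_act /lin_ext; apply: eq_bigr => u _.
rewrite op_act_suml linear_sum scaler_sumr.
apply: eq_bigr => w _; rewrite op_actU fmM linearZ scalerA /=.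
by congr (_ *: _); rewrite /word_op foldr_cat.
Qed.

Record submodule := Submodule {
  sub_carrier : set G;
  sub_closed : GRing.submod_closed [in sub_carrier];
  sub_act : forall a v, sub_carrier v -> sub_carrier (op_act a v)
}.

Variable M : submodule.

Definition ann : {pred opalg} :=
  [pred a | `[< forall v, sub_carrier M v -> op_act a v = 0 >]].

Lemma annP a : reflect (forall v, sub_carrier M v -> op_act a v = 0) (a \in ann).
Proof. exact: asboolP. Qed.

Lemma ann_zmod_closed : zmod_closed ann.
Proof.
split=> [|a b /annP a0 /annP b0]; apply/annP => v Mv; first exact: op_act0l.
by rewrite op_actBl a0 // b0 // subrr.
Qed.

HB.instance Definition _ := GRing.isZmodClosed.Build opalg ann ann_zmod_closed.

Lemma annMl a b : b \in ann -> a * b \in ann.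
Proof. by move=> /annP b0; apply/annP => v Mv; rewrite op_actM b0 // linear0. Qed.

Lemma annMr a b : a \in ann -> a * b \in ann.
Proof. by move=> /annP a0; apply/annP => v Mv; rewrite op_actM a0 //; apply: sub_act. Qed.

(* This is the zero ring when M = 0: hence only a pzRingType. *)
Definition quoalg : Type := Quotient.quot ann.

HB.instance Definition _ := GRing.Zmodule.on quoalg.
HB.instance Definition _ := EqQuotient.on quoalg.

Definition toquo (a : opalg) : quoalg := (\pi_quoalg a)%qT.

Lemma toquoP a b : reflect (toquo a = toquo b) (a - b \in ann).
Proof. by rewrite Quotient.idealrBE; apply: eqP. Qed.

Lemma toquoK x : toquo (repr x) = x. Proof. exact: reprK. Qed.

Lemma toquoD a b : toquo (a + b) = toquo a + toquo b.
Proof. exact: Quotient.pi_add. Qed.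

Definition quo_one : quoalg := toquo 1.
Definition quo_mul (x y : quoalg) : quoalg := toquo (repr x * repr y).
Definition quo_scale (c : C) (x : quoalg) : quoalg := toquo (c *: repr x).

Lemma toquoM a b : quo_mul (toquo a) (toquo b) = toquo (a * b).
Proof.
have annr c : repr (toquo c) - c \in ann by apply/toquoP; rewrite toquoK.
rewrite /quo_mul; apply/toquoP; set a' := repr _; set b' := repr _.
have -> : a' * b' - a * b = (a' - a) * b' + a * (b' - b).
  by rewrite mulrBl mulrBr addrA subrK.
by apply: rpredD; [apply/annMr/annr | apply/annMl/annr].
Qed.

Lemma toquoZ c a : quo_scale c (toquo a) = toquo (c *: a).
Proof.
rewrite /quo_scale; apply/toquoP; rewrite -scalerBr -[X in _ *: X]mul1r scalerAl annMl //.
by apply/toquoP; rewrite toquoK.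
Qed.

Lemma quo_mulA : associative quo_mul.
Proof.
by move=> x y z; rewrite -[x]toquoK -[y]toquoK -[z]toquoK !toquoM mulrA.
Qed.

Lemma quo_mul1 : left_id quo_one quo_mul.
Proof. by move=> x; rewrite -[x]toquoK toquoM mul1r. Qed.

Lemma quo_mulr1 : right_id quo_one quo_mul.
Proof. by move=> x; rewrite -[x]toquoK toquoM mulr1. Qed.

Lemma quo_mulDl : left_distributive quo_mul +%R.
Proof.
move=> x y z; rewrite -[x]toquoK -[y]toquoK -[z]toquoK.
by rewrite -toquoD !toquoM mulrDl toquoD.
Qed.

Lemma quo_mulDr : right_distributive quo_mul +%R.
Proof.
move=> x y z; rewrite -[x]toquoK -[y]toquoK -[z]toquoK.
by rewrite -toquoD !toquoM mulrDr toquoD.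
Qed.

HB.instance Definition _ := GRing.Zmodule_isPzRing.Build quoalg
  quo_mulA quo_mul1 quo_mulr1 quo_mulDl quo_mulDr.

Lemma quo_scaleA c d x : quo_scale c (quo_scale d x) = quo_scale (c * d) x.
Proof. by rewrite -[x]toquoK !toquoZ scalerA. Qed.

Lemma quo_scale1 : left_id 1 quo_scale.
Proof. by move=> x; rewrite -[x]toquoK toquoZ scale1r. Qed.

Lemma quo_scaleDr : right_distributive quo_scale +%R.
Proof.
move=> c x y; rewrite -[x]toquoK -[y]toquoK -toquoD !toquoZ.
by rewrite scalerDr toquoD.
Qed.

Lemma quo_scaleDl x : {morph quo_scale^~ x : c d / c + d}.
Proof. by move=> c d; rewrite -[x]toquoK !toquoZ scalerDl toquoD. Qed.

HB.instance Definition _ := GRing.Zmodule_isLmodule.Build C quoalg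
  quo_scaleA quo_scale1 quo_scaleDr quo_scaleDl.

Definition quoRes (p : P) : quoalg := toquo (symRes p).
Definition quoInd (p : P) : quoalg := toquo (symInd p).

Definition subalgebra_closed (S : set quoalg) : Prop :=
  [/\ 1 \in S, GRing.linear_closed [in S] & GRing.mulr_2closed [in S]].

Definition generated_subalgebra (X : set quoalg) : set quoalg :=
  smallest subalgebra_closed X.

Definition alg_center : set quoalg := [set z | forall x : quoalg, z * x = x * z].

End OperatorAlgebra.

Arguments quoRes {R P} M p.
Arguments quoInd {R P} M p.
Arguments generated_subalgebra {R P M} X.
Arguments alg_center {R P} M.

(* Main.v *)
Require Import Defs.
From HB Require Import structures.
From mathcomp Require Import all_boot all_order all_fingroup all_algebra.
From mathcomp Require Import all_solvable mxrepresentation.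
From mathcomp Require Import boolp classical_sets reals complex.
From mathcomp Require Import finmap monalg.

Set Implicit Arguments.
Unset Strict Implicit.
Unset Printing Implicit Defensive.

Import GRing.Theory Num.Theory.

Local Open Scope ring_scope.

(** Work with characters.  For n odd, the conjugacy classes of D_2n are those of
the rotations r_n^k and of the reflection s_n, so an element v of the module is
determined by the character values [charval n k b v], at r_n^k when b is false
and at s_n when b is true.  In these coordinates the operators are monomial:
Res_q reads the value of level n at level qn, and Ind_q reads the value of level
n at level n/q, or gives 0 when the group element does not come from that level;
it also multiplies by q at rotations and by 1 at reflections ([charval_Res],
[charval_Ind]).  Hence Res_q Ind_q multiplies values at rotations by q and values
at reflections by 1 ([charval_ResInd]), so it is central ([ResInd_comm]).

Conversely, let a represent a central element.  A word with product r of its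
restriction primes and product i of its induction primes reads level xr/i at
level x, unless an intermediate level is below 3 or not an integer.  Since a
commutes with induction, its effect can be computed after inducing to a level
deep enough for no word of a to meet this obstacle; this gives one formula for
all levels ([charval_op_act]): what v of level n contributes to the values of a v at level x
is a scalar [transfer_coef b n x] times a value of v, and this scalar depends
only on the ratio x/n and on the type b ([charval_comm_level],
[transfer_coef_ratio]).

It vanishes unless x = n ([transfer_coef_eq0]).  Let s/t be the reduced form of
x/n.  If a prime q divides s, the level n can be replaced, at constant ratio, by
one whose trivial module is killed by Res_q while the target level lies in the
image of multiplication by q; commuting a past Res_q gives 0.  If q divides t the
same two levels, exchanged, and commutation with Ind_q do it.  So a multiplies
values at rotations by one scalar and values at reflections by another
([charval_comm]); as q <> 1, so does a combination of 1 and Res_q Ind_q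
([comm_ResInd_span]). *)

(** * Characters of semisimple modules *)

Section Characters.
Variables (F : decFieldType) (gT : finGroupType) (G : {group gT}).
Hypothesis F_char0 : [pchar F] =i pred0.

Let F'G : ([pchar F]^'.-group G)%g.
Proof. by rewrite /pgroup; apply/pnatP => // q _ _; rewrite inE /= F_char0. Qed.

(** By Maschke the socle is the whole module, and each isotypic component is a sum
of copies of the standard irreducible representation of its type. *)
Lemma mxtrace_socle_decomp n (rG : mx_representation F G n) (sR : socleType rG)
    (sG : irrType F G) x : x \in G ->
  \tr (rG x) =
    \sum_(W : sR) (socle_mult W)%:R * \tr (irr_repr (irr_comp sG (socle_repr W)) x).
Proof.
move=> Gx.
have full : Socle sR = 1%:M by apply/reducible_Socle1/mx_Maschke_pchar.
have := mxtrace_Socle sR Gx.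
rewrite (mxtrace_submod1 (Socle_module sR)) ?full // => ->.
apply: eq_bigr => W _; rewrite mulr_natl; congr (_ *+ _).
exact: (mxtrace_rsim (rsim_irr_comp_pchar sG F'G (socle_irr W))).
Qed.

(** A linear relation between the characters extends to the group ring, where the
Wedderburn idempotent of one component acts as 1 on its own irreducible
representation and as 0 on the others; the trace of 1 is nonzero in
characteristic 0. *)
Lemma irr_characters_free (sG : irrType F G) (c : sG -> F) :
  (forall x, x \in G -> \sum_i c i * \tr (irr_repr i x) = 0) -> forall i, c i = 0.
Proof.
move=> c0 i.
have c0op A : (A \in group_ring F G)%MS ->
    \sum_j c j * \tr (gring_op (irr_repr j) A) = 0.
  case/envelop_mxP=> a ->.
  transitivity (\sum_(x in G) a x * \sum_j c j * \tr (irr_repr j x)).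
    under [RHS]eq_bigr => x _ do rewrite mulr_sumr.
    rewrite [RHS]exchange_big /=; apply: eq_bigr => j _.
    rewrite !linear_sum mulr_sumr; apply: eq_bigr => x Gx.
    by rewrite !linearZ /= gring_opG // mulrCA.
  by rewrite big1 // => x Gx; rewrite c0 // mulr0.
have : (Wedderburn_id i \in group_ring F G)%MS.
  rewrite -(Wedderburn_sum_pchar sG F'G).
  by apply: (sumsmx_sup i) => //; apply: Wedderburn_id_mem.
move/c0op; rewrite (bigD1 i) //= big1 => [|j ne_ji]; last first.
  by rewrite (irr_repr'_op0_pchar F'G _ (Wedderburn_id_mem i)) 1?eq_sym ?mxtrace0 ?mulr0.
rewrite addr0 op_Wedderburn_id_pchar // mxtrace1 => /eqP; rewrite mulf_eq0.
case/orP=> [/eqP // | ]; move/pcharf0P: F_char0 => -> /eqP d0.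
by have := irr_degree_gt0 i; rewrite d0.
Qed.
End Characters.

(** * Characters of induced dihedral modules *)

Lemma mxtrace_conjg (F : fieldType) (gT : finGroupType) (G : {group gT}) d
    (rG : mx_representation F G d) x y :
  x \in G -> y \in G -> \tr (rG (x ^ y)%g) = \tr (rG x).
Proof.
move=> Gx Gy; rewrite conjgE !repr_mxM ?groupM ?groupV // mxtrace_mulC -mulmxA.
by rewrite repr_mxV // mulmxV ?repr_mx_unit // mulmx1.
Qed.

Section InducedTrace.
Variables (F : fieldType) (gT : finGroupType) (G H : {group gT}).
Variables (d : nat) (rH : mx_representation F H d).

Lemma mxtrace_ind g :
  \tr (ind_mx G rH g) = \sum_(i < #|lcosets H G|)
    (if (g ^ coset_rep i)%g \in H then \tr (rH (g ^ coset_rep i)%g) else 0).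
Proof.
rewrite mxtrace_mxblock; apply: eq_bigr => i _ /=.
by rewrite conjgE mulgA; case: ifP => // _; rewrite mxtrace0.
Qed.

(** Among the chosen representatives exactly one lies in H, that of the coset H. *)
Lemma sum_coset_rep (V : nmodType) (v : V) : H \subset G ->
  \sum_(i < #|lcosets H G|) (if coset_rep i \in H then v else 0) = v.
Proof.
move=> sHG; rewrite -big_mkcond /=.
have lH : (H : {set gT}) \in lcosets H G.
  by apply/lcosetsP; exists 1%g; rewrite ?group1 ?lcoset1.
rewrite (big_pred1 (enum_rank_in lH H)) // => i /=.
have /lcosetsP[x Gx defi] := enum_valP i.
apply/idP/eqP => [Hi | ->].
  apply: enum_val_inj; rewrite enum_rankK_in // defi.
  have : coset_rep i \in (x *: H)%g.
    by rewrite /coset_rep defi; apply: mem_repr (lcoset_refl _ _).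
  move/lcoset_eqP <-; exact: lcoset_id.
by rewrite /coset_rep enum_rankK_in // (mem_repr 1%g) ?group1.
Qed.
End InducedTrace.

Section DihedralTraces.
Variables (p : nat) (m n : level).
Hypothesis def_n : n = (p * m)%N :> nat.

Local Notation emb := (dih_emb_morphism def_n).
Local Notation H := (emb @* [set: dihedral m])%g.

Lemma Zp_natr_eq k l (l' : level) : k = l %[mod l'] -> k%:R = l%:R :> 'Z_l'.
Proof. by move=> eq_kl; rewrite -[LHS]Zp_nat_mod ?eq_kl ?Zp_nat_mod ?level_gt1. Qed.

Lemma dih_emb_nat k b : dih_emb p n (Dih k%:R b : dihedral m) = Dih (p * k)%:R b.
Proof.
rewrite dih_embE //; congr Dih; apply: Zp_natr_eq.
by rewrite /= val_Zp_nat ?level_gt1 // def_n muln_modr modn_mod.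
Qed.

Lemma mem_dih_emb k b : (Dih k%:R b : dihedral n) \in H = (p %| k)%N.
Proof.
apply/idP/idP => [/morphimP[[u c] _ _] | /dvdnP[j ->]]; last first.
  by rewrite mulnC -dih_emb_nat; apply: (mem_morphim emb); rewrite inE.
rewrite /= dih_embE // => -[/(congr1 val)]; rewrite /= !val_Zp_nat ?level_gt1 // => eq_k _.
have p_n : (p %| n)%N by rewrite def_n dvdn_mulr.
have modE j : (p %| j %% n)%N = (p %| j)%N.
  by rewrite [in RHS](divn_eq j n) dvdn_addr // dvdn_mull.
by rewrite -modE eq_k modE dvdn_mulr.
Qed.

Lemma index_dih_emb : #|lcosets H [set: dihedral n]| = p.
Proof.
rewrite card_lcosets -divgS ?finset.subsetT // card_dih ?level_gt1 //.
rewrite card_injm ?injm_dih_emb // ?finset.subsetT // card_dih ?level_gt1 //.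
rewrite def_n -!muln2 -mulnA mulnK // muln_gt0 /=.
by rewrite (leq_trans _ (level_gt2 m)).
Qed.

Lemma conj_rot l u (t : dihedral l) :
  ((Dih u false : dihedral l) ^ t)%g =
    if dih_refl t then (Dih u false)^-1%g else Dih u false.
Proof.
case: t => a []; rewrite conjgE; congr Dih => /=.
  by rewrite opprD addrCA subrr addr0.
by rewrite addrCA addNr addr0.
Qed.

Variables (F : fieldType) (d : nat).

Variable rG : mx_representation F [set: dihedral m] d.

(** All rotations of the small group are normalised up to inversion by the large
one, so each of the p cosets contributes the same value at a rotation.  A
reflection s is conjugated into the subgroup by t only when t itself lies in the
subgroup, because p is odd; so a single coset contributes. *)
Lemma mxtrace_dih_ind k (b : bool) : odd p -> (b -> k = 0%N) ->
  \tr (dih_ind def_n rG (Dih k%:R b)) =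
    if (p %| k)%N then (if b then 1 else p%:R) * \tr (rG (Dih (k %/ p)%:R b)) else 0.
Proof.
move=> p_odd k0; rewrite /dih_ind /= mxtrace_ind.
set rH := eqg_repr _ _.
have rHE x : rH (emb x) = rG x.
  by rewrite /rH /= invmE ?inE.
case: b k0 => [/(_ isT) -> | _].
  rewrite dvdn0 div0n mul1r.
  rewrite -[RHS](sum_coset_rep (\tr (rG (Dih 0%:R true))) (finset.subsetT H)).
  apply: eq_bigr => i _; set t := coset_rep i.
  have s_emb : Dih 0%:R true = emb (Dih 0%:R true) :> dihedral n.
    by rewrite /= dih_emb_nat muln0.
  have -> : (((Dih 0%:R true : dihedral n) ^ t)%g \in H) = (t \in H).
    apply/idP/idP => [Ht | /groupJr ->]; last by rewrite s_emb mem_morphim ?inE.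
    case: t Ht => a c Ht.
    (* The product of s ^ t and s is the rotation by -2a or 2a, where t = r^a s^c. *)
    pose a' := (if c then (a + a) else - (a + a))%R.
    have : (Dih a' false : dihedral n) \in H.
      have -> : (Dih a' false = (Dih 0%:R true ^ Dih a c) * Dih 0%:R true :> dihedral n)%g.
        rewrite conjgE /a'; case: (c); congr Dih => /=;
        by rewrite mulr0n subr0 sub0r ?opprK ?opprD.
      by rewrite groupM // s_emb mem_morphim ?inE.
    have -> : Dih a' false =
        if c then Dih (a + a) false else (Dih (a + a) false)^-1%g :> dihedral n.
      by rewrite /a'; case: (c).
    have -> (y : dihedral n) : ((if c then y else y^-1%g) \in H) = (y \in H).
      by case: ifP => //; rewrite groupV.
    rewrite -{1 2}[a]natr_Zp -natrD mem_dih_emb addnn -muln2 Gauss_dvdl ?coprimen2 //.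
    by rewrite -[a in Dih a c]natr_Zp mem_dih_emb.
  case: ifP => // /morphimP[y _ _ ->].
  by rewrite s_emb -morphJ ?inE // rHE mxtrace_conjg ?inE.
have rotJ i :
    ((Dih k%:R false : dihedral n) ^ (coset_rep i : dihedral n))%g \in H = (p %| k)%N.
  by rewrite conj_rot -(mem_dih_emb _ false); case: ifP => //; rewrite groupV.
under eq_bigr => i _ do rewrite rotJ.
case: ifP => [/dvdnP[j ->] | _]; last by rewrite big1.
have p_gt0 : (0 < p)%N by case: (p) p_odd.
rewrite mulnK // mulnC (eq_bigr (fun=> \tr (rG (Dih j%:R false)))).
  by rewrite sumr_const card_ord index_dih_emb mulr_natl.
move=> i _; rewrite conj_rot -dih_emb_nat -[dih_emb _ _ _]/(emb _).
case: ifP => _; last by rewrite rHE.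
rewrite -morphV ?inE // rHE.
have -> : ((Dih j%:R false : dihedral m)^-1 = Dih j%:R false ^ dih_s)%g.
  by rewrite conj_rot.
by rewrite mxtrace_conjg ?inE.
Qed.
End DihedralTraces.

(** * Character values on the Grothendieck group *)

Section CharacterValues.
Variable R : realType.
Local Notation C := R[i].
Implicit Types (v : groth R) (n k : nat) (b : bool).

(** The value at r_n^k s_n^b of the component of level n.  The level is a natural
number, not a [level], so that it can be multiplied and divided freely, and the
value is 0 below level 3.  Reflections are only evaluated with k = 0, which
suffices for odd n and avoids reducing exponents of reflections. *)
Definition charval n k b : groth R -> C^o :=
  lin_ext (fun S : simple_module R =>
    if tag S == n :> nat then \tr (irr_repr (tagged S) (Dih k%:R b)) else 0 : C^o).

HB.instance Definition _ n k b := GRing.Linear.on (charval n k b).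

Lemma lin_extU (K : choiceType) (V : lmodType C) (f : K -> V) x :
  lin_ext f << x >> = f x.
Proof. by rewrite (lin_extEw _ msuppU_le) big_seq_fset1 mcoeffUU scale1r. Qed.

Lemma charvalZ n k b c v : charval n k b (c *: v) = c * charval n k b v.
Proof. exact: linearZ_LR. Qed.

Lemma charval_comb n k b c d u v :
  charval n k b (c *: u + d *: v) = c * charval n k b u + d * charval n k b v.
Proof.
exact: etrans (linearD _ _ _) (congr2 +%R (charvalZ _ _ _ _ _) (charvalZ _ _ _ _ _)).
Qed.

Lemma groth_decomp v : v = \sum_(S <- msupp v) v@_S *: simple_class S.
Proof.
rewrite {1}[v]monalgE; apply: eq_bigr => S _.
apply/malgP => T; apply: etrans (mcoeffU _ _ _) (esym (etrans (mcoeffZ _ _ _) _)).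
by rewrite /simple_class mcoeffU mulr_natr.
Qed.

Lemma groth_linear_eq (V : lmodType C) (f g : {linear groth R -> V}) :
  (forall S, f (simple_class S) = g (simple_class S)) -> f =1 g.
Proof.
move=> eq_fg v; rewrite [v]groth_decomp !linear_sum; apply: eq_bigr => S _.
by rewrite !linearZ /= eq_fg.
Qed.

Lemma charval_simple n k b S :
  charval n k b (simple_class S) =
    if tag S == n :> nat then \tr (irr_repr (tagged S) (Dih k%:R b)) else 0.
Proof. exact: lin_extU. Qed.

Lemma charval_small n k b v : (n <= 2)%N -> charval n k b v = 0.
Proof.
move=> n_le2; rewrite [v]groth_decomp linear_sum big1 // => S _.
rewrite linearZ /= charval_simple; case: eqP => [def_n | _]; last by rewrite scaler0.
by move: n_le2; rewrite -def_n leqNgt level_gt2.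
Qed.

Lemma complex_char0 : [pchar C] =i pred0.
Proof. exact: pchar_num. Qed.

Lemma charval_mod_class (l : level) d (rG : mx_representation C [set: dihedral l] d) n k b :
  charval n k b (mod_class rG) = if l == n :> nat then \tr (rG (Dih k%:R b)) else 0.
Proof.
rewrite linear_sum /=; case: ifP => eq_ln; last first.
  by rewrite big1 // => W _; rewrite linearZ /= charval_simple /= eq_ln scaler0.
rewrite (mxtrace_socle_decomp complex_char0 (DecSocleType rG) (simples R l)) ?inE //.
by apply: eq_bigr => W _; rewrite linearZ /= charval_simple /= eq_ln.
Qed.

Lemma charval_Res (p : prime_nat) n k b v : (2 < n)%N ->
  charval n k b (Res p v) = charval (p * n) (p * k) b v.
Proof.
move=> n_gt2; have p_gt0 : (0 < p)%N by rewrite prime_gt0 ?prime_natP.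
apply: (@groth_linear_eq C^o (charval n k b \o @Res R p) (charval (p * n) (p * k) b)).
move=> S /=; rewrite charval_simple /Res lin_extU.
case: eqP => [def_S | ne_S].
  case: {-}_ / idP => [p_dv | ]; last by case; rewrite def_S dvdn_mulr.
  case: {-}_ / idP => [gt2 | ]; last by case; rewrite def_S mulKn.
  rewrite charval_mod_class /= {1}def_S mulKn // eqxx.
  by rewrite (dih_emb_nat (res_level_proof gt2 p_dv)).
case: {-}_ / idP => [p_dv | _]; last by rewrite linear0.
case: {-}_ / idP => [gt2 | _]; last by rewrite linear0.
rewrite charval_mod_class /=; case: eqP => // def_n.
by case: ne_S; rewrite -def_n mulnC divnK.
Qed.

Lemma charval_Ind (p : prime_nat) n k b v : odd p -> (b -> k = 0%N) ->
  charval n k b (Ind p v) =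
    if (p %| n)%N && (p %| k)%N
    then (if b then 1 else p%:R) * charval (n %/ p) (k %/ p) b v else 0.
Proof.
move=> p_odd k0; have p_gt0 : (0 < p)%N by rewrite prime_gt0 ?prime_natP.
pose c : C := if (p %| n)%N && (p %| k)%N then if b then 1 else p%:R else 0.
transitivity (c *: charval (n %/ p) (k %/ p) b v); last first.
  by rewrite /c; case: ifP; rewrite // scale0r.
apply: (@groth_linear_eq C^o (charval n k b \o @Ind R p) (c \*: charval (n %/ p) (k %/ p) b)).
move=> S /=; rewrite charval_simple /Ind lin_extU charval_mod_class mxtrace_dih_ind //= {}/c.
have -> : (p * tag S == n)%N = (p %| n)%N && (tag S == n %/ p :> nat)%N.
  apply/eqP/andP => [<- | [p_dv /eqP ->]]; last by rewrite mulnC divnK.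
  by rewrite dvdn_mulr // mulKn.
by case: (p %| n)%N; case: (_ == _); case: (p %| k)%N; rewrite /= ?scaler0 ?scale0r ?mul0r.
Qed.

Lemma dih_reflection_conj (n : level) (a : 'Z_n) : odd n ->
  exists t : dihedral n, Dih a true = (Dih 0%:R true ^ t)%g.
Proof.
(* The rotation part is -a/2, since n./2 is -1/2 modulo the odd number n. *)
move=> n_odd; exists (Dih (a *+ n./2) false); rewrite conjgE; congr Dih => /=.
rewrite mulr0n sub0r -opprD -mulrnDr addnn; apply/eqP; rewrite -addr_eq0.
rewrite -mulrS -[X in _ *+ X]/(true + _)%N -{1}n_odd odd_double_half.
by rewrite -mulr_natr pchar_Zp ?level_gt1 // mulr0.
Qed.

(** For odd n every reflection is conjugate to s_n, so the values considered are all
the values of a virtual character of level n, and irreducible characters are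
linearly independent. *)
Lemma charval_eq0 v : (forall S, v@_S != 0 -> odd (tag S)) ->
  (forall n k b, (b -> k = 0%N) -> charval n k b v = 0) -> v = 0.
Proof.
move=> v_odd v0; apply/malgP => S; rewrite mcoeff0; apply/eqP.
apply: contraT => nz_vS; have n_odd := v_odd _ nz_vS; case/eqP: nz_vS.
case: S n_odd => n i /= n_odd.
pose T (j : simples R n) : simple_module R := Tagged (simples R) j.
have key k b : (b -> k = 0%N) -> \sum_j v@_(T j) * \tr (irr_repr j (Dih k%:R b)) = 0.
  move=> k0; rewrite -[RHS](v0 n k b k0) /charval /lin_ext.
  pose F (S : simple_module R) : C := v@_S * \tr (irr_repr (tagged S) (Dih k%:R b)).
  (* Regroups the sum over the support of v by simple modules of level n. *)
  transitivity (\sum_j \sum_(S <- msupp v | S == T j) F S).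
    apply: eq_bigr => j _; case: (boolP (T j \in msupp v)) => [Tj | ].
      rewrite -big_filter (perm_big [:: T j]) ?big_seq1 //.
      apply: uniq_perm; rewrite ?filter_uniq ?fset_uniq // => S.
      by rewrite mem_filter mem_seq1; case: eqP => // ->.
    move/mcoeff_outdom=> v0j; rewrite v0j mul0r big1_seq // => S /andP[/eqP -> _].
    by rewrite /F v0j mul0r.
  rewrite (exchange_big_dep xpredT) //=; apply: eq_bigr => -[l j] _ /=.
  case: eqP => [/val_inj/esym def_l | ne_l]; last first.
    by rewrite big1 ?scaler0 // => j' /eqP[/(congr1 val)].
  case: _ / def_l in j *.
  by rewrite (big_pred1 j) // => j'; rewrite /T eq_sym eq_Tagged.
apply: (irr_characters_free complex_char0 (c := fun j => v@_(T j))) i => -[a []] _.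
  have [t ->] := dih_reflection_conj a n_odd.
  by under eq_bigr => j _ do rewrite mxtrace_conjg ?inE //; apply: key.
by rewrite -[a]natr_Zp; apply: key.
Qed.

End CharacterValues.

(** * The action of words on character values *)

Section Words.
Variables (R : realType) (P : set prime_nat).
Hypothesis P_odd : forall q : prime_nat, P q -> odd q.
Local Notation C := R[i].
Implicit Types (w : seq (op_sym P)) (v : groth R) (x y n k : nat) (b : bool).

Definition ind_primes w : seq P := pmap (fun g => if g is GInd q then Some q else None) w.
Definition res_primes w : seq P := pmap (fun g => if g is GRes q then Some q else None) w.
Definition prime_prod (s : seq P) : nat := (\prod_(q <- s) (val q : nat))%N.
Local Notation ind_prod w := (prime_prod (ind_primes w)).
Local Notation res_prod w := (prime_prod (res_primes w)).

(** The factor by which inductions along primes of product m multiply values at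
rotations (b false) and at reflections (b true). *)
Definition ind_coef b (m : nat) : C := if b then 1 else m%:R.

Lemma op_act_ResInd (q : P) v :
  op_act (symRes R q * symInd R q) v = Res (val q) (Ind (val q) v).
Proof. by rewrite op_actM !op_actU !scale1r !fmuE. Qed.

Lemma op_act_sym (g : op_sym P) v : op_act << fmu g >> v = sym_op g v.
Proof. by rewrite op_actU scale1r fmuE. Qed.

Lemma op_actZl c (a : opalg R P) v : op_act (c *: a) v = c *: op_act a v.
Proof. by rewrite -[c *: a]addr0 op_act_linearl op_act0l addr0. Qed.

(** A scalar moves out of the right factor because e acts linearly. *)
Lemma op_act_scaler c (a e : opalg R P) v :
  op_act (e * (c *: a)) v = op_act (c *: (e * a)) v.
Proof.
transitivity (c *: op_act e (op_act a v)).
  apply: etrans (op_actM e (c *: a) v) _; rewrite (op_actZl c a v).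
  exact: linearZ_LR.
by rewrite -(op_actM e a v) -(op_actZl c (e * a) v).
Qed.

Lemma linear_op_act (h : {linear groth R -> groth R}) (a : opalg R P) v :
  (forall w : seq (op_sym P), h (word_op w v) = word_op w (h v)) ->
  h (op_act a v) = op_act a (h v).
Proof.
move=> h_word; rewrite /op_act /lin_ext linear_sum; apply: eq_bigr => w _.
by rewrite linearZ /= h_word.
Qed.

Lemma odd_val (q : P) : odd (val q).
Proof. by apply: P_odd; apply: set_mem (valP q). Qed.

Lemma prime_prod_gt0 s : (0 < prime_prod s)%N.
Proof. by rewrite prodn_gt0 // => q; rewrite prime_gt0 ?prime_natP. Qed.

Lemma prime_prod_cons q s : prime_prod (q :: s) = (val q * prime_prod s)%N.
Proof. by rewrite /prime_prod big_cons. Qed.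

Lemma odd_prime_prod s : odd (prime_prod s).
Proof.
elim: s => [|q s IHs]; first by rewrite /prime_prod big_nil.
by rewrite prime_prod_cons oddM odd_val.
Qed.

Lemma prime_dvd_prime_prod s q : prime q -> (q %| prime_prod s)%N ->
  exists r : P, val r = q :> nat.
Proof.
move=> q_pr; elim: s => [|r s IHs].
  by rewrite /prime_prod big_nil dvdn1 => /eqP q1; rewrite q1 in q_pr.
rewrite prime_prod_cons Euclid_dvdM // => /orP[|//].
by rewrite dvdn_prime2 ?prime_natP // => /eqP ->; exists r.
Qed.

Lemma ind_coefM b m1 m2 : ind_coef b (m1 * m2) = ind_coef b m1 * ind_coef b m2.
Proof. by case: b; rewrite /= ?mulr1 // natrM. Qed.

Lemma ind_coef_neq0 b s : ind_coef b (prime_prod s) != 0.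
Proof. by case: b; rewrite /= ?oner_eq0 // pnatr_eq0 -lt0n prime_prod_gt0. Qed.

(** The levels met while reading the word stay multiples of x, hence above 2: this
is the case in which no restriction is truncated to 0. *)
Lemma charval_word w v x y b : (2 < x)%N -> (b -> y = 0%N) ->
  charval (x * ind_prod w) (y * ind_prod w) b (word_op w v)
  = ind_coef b (ind_prod w) *
    charval (x * res_prod w) (y * res_prod w) b v.
Proof.
elim: w x y => [|[] q w IHw] x y x_gt2 y0 /=.
- by rewrite /prime_prod !big_nil; case: (b); rewrite mul1r.
- have x'_gt2 : (2 < x * ind_prod w)%N.
    by rewrite (leq_trans x_gt2) // leq_pmulr // prime_prod_gt0.
  rewrite -[sval q]/(val q) charval_Res // !mulnA IHw; last first.
  + by move/y0->; rewrite muln0.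
  + by rewrite (leq_trans x_gt2) // leq_pmull // prime_gt0 // prime_natP.
  by rewrite prime_prod_cons !(mulnCA _ (val q)) !mulnA.
rewrite -[sval q]/(val q) prime_prod_cons charval_Ind ?odd_val //; last by move/y0->; rewrite mul0n.
have q_gt0 : (0 < val q)%N by rewrite prime_gt0 // prime_natP.
have qCA z : (z * (val q * ind_prod w) = val q * (z * ind_prod w))%N by apply: mulnCA.
by rewrite !qCA !(dvdn_mulr _ (dvdnn _)) 2!(mulKn _ q_gt0) IHw // ind_coefM mulrA.
Qed.

Lemma charval_ind_word (s : seq P) v n k b : (b -> k = 0%N) ->
  charval n k b (word_op [seq GInd q | q <- s] v) =
    if (prime_prod s %| n)%N && (prime_prod s %| k)%N
    then ind_coef b (prime_prod s) * charval (n %/ prime_prod s) (k %/ prime_prod s) b v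
    else 0.
Proof.
elim: s n k => [|q s IHs] n k k0 /=.
  by rewrite /prime_prod big_nil !dvd1n !divn1; case: (b); rewrite mul1r.
rewrite -[sval q]/(val q) (charval_Ind _ _ (odd_val q) k0) IHs; last by move/k0->; rewrite div0n.
have q_gt0 : (0 < val q)%N by rewrite prime_gt0 // prime_natP.
rewrite prime_prod_cons ind_coefM.
have dvdE j : (val q * prime_prod s %| j)%N = (val q %| j)%N && (prime_prod s %| j %/ val q)%N.
  apply/idP/andP => [qs_j | [q_j s_j]].
    have q_j : (val q %| j)%N := dvdn_trans (dvdn_mulr _ (dvdnn _)) qs_j.
    by split=> //; rewrite -(dvdn_pmul2l q_gt0) [X in (_ %| X)%N]mulnC divnK.
  by rewrite -(divnK q_j) mulnC dvdn_pmul2r.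
rewrite !dvdE !divnMA; by do 4!case: (dvdn _ _); rewrite /= ?mulr0 ?mulrA.
Qed.

(** Inducing v along all the induction primes of a brings every word of a into the
range of [charval_word]; commuting a with this induction and cancelling its
nonzero factor gives a formula at every level. *)
Lemma charval_op_act a v x y b : (2 < x)%N -> (b -> y = 0%N) ->
  (forall w, op_act a (word_op w v) = word_op w (op_act a v)) ->
  charval x y b (op_act a v) =
    \sum_(w <- msupp a) a@_w * (ind_coef b (ind_prod w) *
      if (ind_prod w %| x * res_prod w)%N &&
         (ind_prod w %| y * res_prod w)%N
      then charval (x * res_prod w %/ ind_prod w)
                   (y * res_prod w %/ ind_prod w) b v
      else 0).
Proof.
move=> x_gt2 y0 a_comm.
pose s := flatten [seq ind_primes w | w : {fmonom op_sym P} <- msupp a].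
pose K := prime_prod s; have K_gt0 : (0 < K)%N := prime_prod_gt0 s.
have K_dvd (w : {fmonom op_sym P}) : w \in msupp a -> (ind_prod w %| K)%N.
  move=> a_w; rewrite /K /s /prime_prod big_flatten big_map /=.
  by rewrite (perm_big _ (perm_to_rem a_w)) big_cons dvdn_mulr.
apply: (mulfI (ind_coef_neq0 b s)).
have := charval_ind_word s (op_act a v) (x * K) (k := y * K) (b := b).
rewrite !dvdn_mull // !mulnK //= => <-; last by move/y0->.
rewrite -a_comm /op_act /lin_ext linear_sum mulr_sumr; apply: eq_big_seq => w a_w /=.
rewrite linearZ /= [RHS]mulrCA -[LHS]/(a@_w * _); congr (_ * _).
set I := ind_prod w; set r := res_prod w.
have /dvdnP[c defK] := K_dvd w a_w; rewrite -/I in defK.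
have [c_gt0 I_gt0] : (0 < c)%N /\ (0 < I)%N by apply/andP; rewrite -muln_gt0 -defK.
rewrite defK !mulnA charval_word; last first.
- by move/y0->.
- by rewrite (leq_trans x_gt2) // leq_pmulr.
rewrite mulrCA; congr (_ * _); rewrite -/r charval_ind_word; last by move/y0->.
rewrite -/K defK ![(_ * c * r)%N]mulnAC ![(_ * c)%N]mulnC !dvdn_pmul2l // !divnMl //.
by case: ifP; rewrite ?mulr0.
Qed.
End Words.

Notation ind_prod w := (prime_prod (ind_primes w)).
Notation res_prod w := (prime_prod (res_primes w)).

(** * Arithmetic of levels *)

Definition smooth_over (PS : nat -> Prop) (t : nat) : Prop :=
  (0 < t)%N /\ forall q, prime q -> (q %| t)%N -> PS q.

(** N is the set of levels of a module stable under induction and restriction along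
the primes in PS. *)
Section LevelArithmetic.
Variables (N PS : nat -> Prop).
Hypothesis N_gt2 : forall n, N n -> (2 < n)%N.
Hypothesis N_mul : forall n q, PS q -> N n -> N (q * n)%N.
Hypothesis N_div : forall n q, PS q -> (2 < n)%N -> N (q * n)%N -> N n.
Hypothesis PS_prime : forall q, PS q -> prime q.
Local Notation smooth := (smooth_over PS).

Lemma smooth_ind (Q : nat -> Prop) : Q 1%N ->
  (forall q t, PS q -> Q t -> Q (q * t)%N) -> forall t, smooth t -> Q t.
Proof.
move=> Q1 QM t; have [k] := ubnP t; elim: k t => // k IHk t le_tk [t_gt0 t_PS].
case: (ltngtP t 1) => [|t_gt1|->] //; first by rewrite ltnNge t_gt0.
have q_pr := pdiv_prime t_gt1; have q_dv := pdiv_dvd t.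
have PSq := t_PS _ q_pr q_dv.
rewrite -(divnK q_dv) mulnC; apply: QM => //; apply: IHk.
  by rewrite -ltnS (leq_trans _ le_tk) // ltnS ltn_Pdiv // prime_gt1.
split=> [|r r_pr r_dv]; first by rewrite divn_gt0 ?prime_gt0 // dvdn_leq.
by apply: t_PS => //; apply: dvdn_trans r_dv (dvdn_div q_dv).
Qed.

Lemma level_smooth_mul n t : smooth t -> N n -> N (t * n)%N.
Proof.
move=> t_sm Nn; elim/smooth_ind: t / t_sm => [|q t PSq IHt]; first by rewrite mul1n.
by rewrite -mulnA; apply: N_mul.
Qed.

Lemma level_smooth_div n t : smooth t -> (2 < n)%N -> N (t * n)%N -> N n.
Proof.
move=> t_sm n_gt2; elim/smooth_ind: t / t_sm => [|q t PSq IHt]; first by rewrite mul1n.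
case: t IHt => [|t] IHt; first by rewrite muln0 => /N_gt2.
rewrite -mulnA => Nqt; apply/IHt/(N_div PSq) => //.
by rewrite (leq_trans n_gt2) // leq_pmull.
Qed.

(** From n' no further restriction along q is possible inside N. *)
Lemma strip_prime n q : PS q -> N n -> exists2 n', N n' &
  (exists e, n = n' * q ^ e)%N /\ forall m, n' = (q * m)%N -> (m <= 2)%N.
Proof.
move=> PSq; have [k] := ubnP n; elim: k n => // k IHk n le_nk Nn.
case: (pselect (exists2 m, n = (q * m)%N & (2 < m)%N)) => [[m def_n m_gt2] | no_m].
  have Nm : N m by apply: N_div PSq m_gt2 _; rewrite -def_n.
  have lt_mn : (m < n)%N.
    by rewrite def_n ltn_Pmull ?prime_gt1 ?PS_prime // (leq_trans _ m_gt2).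
  have [n' Nn' [[e def_m] n'_min]] := IHk m (leq_trans lt_mn (ltnSE le_nk)) Nm.
  exists n' => //; split=> //; exists e.+1.
  by rewrite def_n def_m expnS mulnCA.
exists n => //; split=> [|m def_n]; first by exists 0%N; rewrite expn0 muln1.
by rewrite leqNgt; apply/negP => m_gt2; case: no_m; exists m.
Qed.

(** A pair of levels n1 and qm of ratio t : s such that n1 cannot be restricted along
q, whereas qm can.  It is obtained by stripping q from a multiple of t^2: one
factor t makes the ratio integral, and the other keeps m above 2 when t > 1. *)
Lemma separating_levels n q s t : N n -> PS q -> coprime s t -> (q %| s)%N ->
    smooth s -> smooth t -> odd t ->
  exists n1 m, [/\ N n1, N m, (forall m', n1 = q * m' -> m' <= 2)%N &
                   (q * m * t = s * n1)%N].
Proof.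
move=> Nn PSq co_st q_s s_sm t_sm t_odd.
have q_pr := PS_prime PSq.
have co_qt : coprime q t by apply: coprime_dvdl co_st.
have [n1 Nn1 [[e def_n1] n1_min]] := strip_prime PSq
  (level_smooth_mul t_sm (level_smooth_mul t_sm Nn)).
have /dvdnP[j def_j] : (t * t %| n1)%N.
  rewrite -(@Gauss_dvdl _ _ (q ^ e)); last by rewrite coprime_sym coprimeXl // coprimeMr co_qt.
  by rewrite -def_n1 mulnA dvdn_mulr.
have n1_gt2 := N_gt2 Nn1; have t_gt0 := t_sm.1.
have j_gt0 : (0 < j)%N by case: (j) def_j n1_gt2 => // ->; rewrite mul0n.
have tj_gt2 : (2 < t * j)%N.
  case: (ltngtP t 1) => [|t_gt1|t1]; first by rewrite ltnNge t_gt0.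
    have t_gt2 : (2 < t)%N.
      by case: t t_odd t_gt1 {co_st t_sm co_qt def_n1 def_j t_gt0} => [|[|[]]].
    by rewrite (leq_trans t_gt2) // leq_pmulr.
  by move: n1_gt2; rewrite def_j t1 !muln1 mul1n.
exists n1, (s %/ q * (t * j))%N; split=> //; last first.
  by rewrite def_j mulnA [(q * _)%N]mulnC divnK // -!mulnA [(t * (j * t))%N]mulnCA.
apply: level_smooth_mul.
  split=> [|r r_pr r_dv]; first by rewrite divn_gt0 ?prime_gt0 // dvdn_leq ?s_sm.1.
  by apply: s_sm.2 => //; apply: dvdn_trans r_dv (dvdn_div q_s).
by apply: level_smooth_div t_sm tj_gt2 _; rewrite mulnA mulnC -def_j.
Qed.
End LevelArithmetic.

(** * Modules that are full at each level *)

Lemma triv_mx_repr (F : fieldType) (gT : finGroupType) (G : {group gT}) :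
  mx_repr G (fun _ : gT => 1%:M : 'M[F]_1).
Proof. by split=> // x y _ _; rewrite mul1mx. Qed.

(** The trivial module is a convenient test vector: its value is 1 at all elements,
rotations and reflections alike. *)
Definition triv_class (R : realType) (n : level) : groth R :=
  mod_class (MxRepresentation (triv_mx_repr R[i] [set: dihedral n])).

Lemma charval_triv (R : realType) (l : level) n k b :
  charval n k b (triv_class R l) = (l == n :> nat)%:R.
Proof. by rewrite charval_mod_class /= mxtrace1; case: ifP. Qed.

Section Module.
Variables (R : realType) (P : set prime_nat).
Hypothesis P_odd : forall q : prime_nat, P q -> odd q.
Variable M : submodule R P.
Variable B : set (simple_module R).
Hypothesis B_odd : forall S, B S -> odd (tag S).
Hypothesis M_span : sub_carrier M = lin_span [set simple_class S | S in B]%classic.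
Hypothesis M_full : forall n : level,
  (forall S : simple_module R, tag S = n -> sub_carrier M (simple_class S)) \/
  (forall S : simple_module R, tag S = n -> ~ sub_carrier M (simple_class S)).
Implicit Types (v : groth R) (n k x y : nat) (b : bool).
Local Notation C := R[i].
Local Notation "v \inM" := (sub_carrier M v) (at level 70).

Lemma subM_lin c u v : u \inM -> v \inM -> (c *: u + v) \inM.
Proof.
have [_ M_lin] := sub_closed M => Mu Mv.
by apply: set_mem; apply: M_lin; apply: mem_set.
Qed.

Lemma subM0 : 0 \inM.
Proof. by have [M0 _] := sub_closed M; apply: set_mem. Qed.

Lemma simple_subM S : B S -> simple_class S \inM.
Proof. by move=> BS; rewrite M_span; apply: sub_gen_smallest; exists S. Qed.

(** The elements of the free space supported on B form a subspace containing the
generators of M. *)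
Lemma subM_supp v S : v \inM -> v@_S != 0 -> B S.
Proof.
rewrite M_span => Mv; move: S.
suff: (lin_span [set simple_class S | S in B] `<=`
   [set v | forall S, v@_S != 0 -> B S])%classic by move=> /(_ _ Mv).
apply: smallest_sub => [|_ [S BS <-] T]; last first.
  by rewrite mcoeffU; case: (S =P T) => [<- //|_]; rewrite mulr0n eqxx.
split=> [|c u w]; first by apply/mem_set => S; rewrite mcoeff0 eqxx.
move=> /set_mem /= Bu /set_mem /= Bw; apply/mem_set => S /=.
rewrite mcoeffD mcoeffZ; case: (u@_S =P 0) => [->|/eqP uS _]; last exact: Bu.
by rewrite mulr0 add0r; apply: Bw.
Qed.

Lemma subM_charval_eq0 v : v \inM ->
  (forall n k b, (b -> k = 0%N) -> charval n k b v = 0) -> v = 0.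
Proof. by move=> Mv; apply: charval_eq0 => S /(subM_supp Mv)/B_odd. Qed.

Lemma word_subM (w : seq (op_sym P)) v : v \inM -> word_op w v \inM.
Proof.
move=> Mv; elim: w => // g w Mw; rewrite /= -[sym_op _ _]/(word_op [:: g] _).
have := sub_act << fmu g >> Mw; rewrite op_actU scale1r.
by rewrite fmuE.
Qed.

Lemma Res_subM (q : P) v : v \inM -> Res (val q) v \inM.
Proof. exact: (@word_subM [:: GRes q]). Qed.

Lemma Ind_subM (q : P) v : v \inM -> Ind (val q) v \inM.
Proof. exact: (@word_subM [:: GInd q]). Qed.

(** Membership of the trivial module is equivalent, by fullness, to membership of all
simple modules of level n, and is easier to use. *)
Definition in_level (n : nat) := exists l : level, l = n :> nat /\ triv_class R l \inM.

Lemma in_levelP (l : level) : in_level l <-> triv_class R l \inM.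
Proof.
by split=> [[l' [/val_inj ->]] | Ml] //; exists l.
Qed.

(** A nonzero value forces some simple module of level l into M, hence all of them. *)
Lemma charval_in_level (l : level) k b v : v \inM -> charval l k b v != 0 -> in_level l.
Proof.
move=> Mv nz_v.
have [S BS def_l] : exists2 S, B S & tag S = l.
  apply: contra_neqP nz_v => noB; rewrite [v]groth_decomp linear_sum big1_seq // => S.
  rewrite /= -mcoeff_neq0 => vS; rewrite linearZ /= charval_simple.
  case: eqP => [/val_inj def_l | _]; last by rewrite scaler0.
  by case: noB; exists S => //; apply: subM_supp Mv vS.
apply/in_levelP; case: (M_full l) => [Ml | /(_ S def_l)[]]; last exact: simple_subM.
rewrite /triv_class /mod_class.
elim/big_ind: _ => [|u w Mu Mw|W _]; first exact: subM0.
  by rewrite -[u]scale1r; apply: subM_lin.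
rewrite -[_ *: _]addr0; apply: subM_lin; last exact: subM0.
exact: Ml.
Qed.

Lemma simple_in_level S : simple_class S \inM -> in_level (tag S).
Proof.
move=> MS; apply: (charval_in_level (k := 0) (b := false) MS).
have eq1 : Dih 0%:R false = 1%g :> dihedral (tag S) by [].
rewrite charval_simple eqxx eq1 repr_mx1 mxtrace1.
by rewrite pnatr_eq0 -lt0n irr_degree_gt0.
Qed.

Lemma in_level_gt2 n : in_level n -> (2 < n)%N.
Proof. by case=> l [<- _]; apply: level_gt2. Qed.

Lemma in_level_mul n (q : P) : in_level n -> in_level (val q * n)%N.
Proof.
case=> l [<- Ml]; apply: (@charval_in_level (mul_level (val q) l) 0 false _ (Ind_subM q Ml)).
rewrite charval_Ind ?odd_val //= dvdn0 dvdn_mulr // mulKn ?prime_gt0 ?prime_natP //.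
by rewrite charval_triv eqxx mulr1 pnatr_eq0 -lt0n prime_gt0 ?prime_natP.
Qed.

Lemma in_level_div n (q : P) : (2 < n)%N -> in_level (val q * n)%N -> in_level n.
Proof.
move=> n_gt2 [l [def_l Ml]].
apply: (@charval_in_level (Level n_gt2) 0 false _ (Res_subM q Ml)).
by rewrite charval_Res //= muln0 charval_triv def_l eqxx oner_eq0.
Qed.

(** * Elements acting centrally *)

Section Commuting.
Variable a : opalg R P.
Hypothesis a_comm : forall (g : op_sym P) v, v \inM ->
  op_act a (sym_op g v) = sym_op g (op_act a v).

Lemma comm_word (w : seq (op_sym P)) v : v \inM ->
  op_act a (word_op w v) = word_op w (op_act a v).
Proof.
by move=> Mv; elim: w => //= g w IHw; rewrite a_comm ?IHw //; apply: word_subM.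
Qed.

(** The part of a made of the words that read level n at level x, weighted by the
factors of their inductions. *)
Definition transfer_coef b (n x : nat) : C :=
  \sum_(w <- msupp a | (x * res_prod w == n * ind_prod w)%N)
    a@_w * ind_coef R b (ind_prod w).

Lemma transfer_coef_ratio b n x n' x' : (0 < n)%N -> (0 < n')%N ->
  (x * n' = x' * n)%N -> transfer_coef b n x = transfer_coef b n' x'.
Proof.
move=> n_gt0 n'_gt0 eq_ratio; apply: eq_bigl => w.
rewrite /= -(eqn_pmul2r n'_gt0) -[in RHS](eqn_pmul2r n_gt0).
rewrite mulnAC eq_ratio mulnAC; congr (_ == _).
by rewrite mulnC mulnCA mulnC.
Qed.

(** When v is concentrated at level n, only the words with x r = n i survive in
[charval_op_act], and they all read the same value of v. *)
Lemma charval_comm_level n v x y b : v \inM ->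
    (forall m k (c : bool), (c -> k = 0%N) -> m != n -> charval m k c v = 0) ->
    (2 < x)%N -> (b -> y = 0%N) ->
  charval x y b (op_act a v) =
    if (x %| y * n)%N then transfer_coef b n x * charval n (y * n %/ x) b v else 0.
Proof.
move=> Mv v_n x_gt2 y0; rewrite charval_op_act //; last by move=> w; apply: comm_word.
have x_gt0 : (0 < x)%N by apply: ltn_trans x_gt2.
transitivity (\sum_(w <- msupp a | (x * res_prod w == n * ind_prod w)%N)
    a@_w * ind_coef R b (ind_prod w) *
     (if (x %| y * n)%N then charval n (y * n %/ x) b v else 0)); last first.
  by rewrite -mulr_suml; case: ifP; rewrite ?mulr0.
rewrite [RHS]big_mkcond; apply: eq_bigr => w _ /=.
set I := ind_prod w; set r := res_prod w.
have I_gt0 : (0 < I)%N by apply: prime_prod_gt0.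
case: eqP => [eq_xr | ne_xr]; last first.
  case: ifP => [/andP[I_xr _] | _]; last by rewrite !mulr0.
  rewrite v_n ?mulr0 //; first by move/y0->; rewrite mul0n div0n.
  apply/eqP => def_n; case: ne_xr.
  by rewrite -(divnK I_xr) def_n.
rewrite eq_xr (dvdn_mull _ (dvdnn _)) (mulnK _ I_gt0) -mulrA.
apply: (congr1 (fun c => a@_w * (ind_coef R b I * c))) => /=.
have -> : (I %| y * r)%N = (x %| y * n)%N.
  by rewrite -(dvdn_pmul2l x_gt0) mulnCA eq_xr mulnA dvdn_pmul2r.
case x_yn: (x %| y * n)%N; last by [].
have /dvdnP[d def_d] := x_yn.
suff -> : (y * r = d * I)%N by rewrite def_d !mulnK.
by apply/eqP; rewrite -(eqn_pmul2l x_gt0) mulnCA eq_xr mulnA def_d mulnCA mulnA.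
Qed.

(** Res_q kills the trivial module of level n, so the value of a applied to it at
level qm, being the value at level m of Res_q of that, is 0. *)
Lemma transfer_coef_res b n m (q : P) : in_level n -> (2 < m)%N ->
  (forall m', n = val q * m' -> m' <= 2)%N -> transfer_coef b n (val q * m) = 0.
Proof.
case=> l [<- Ml] m_gt2 l_min.
have q_gt0 : (0 < val q)%N by rewrite prime_gt0 ?prime_natP.
have qm_gt2 : (2 < val q * m)%N by rewrite (leq_trans m_gt2) // leq_pmull.
have triv_l (m' : nat) k (c : bool) : (c -> k = 0)%N -> m' != l ->
    charval m' k c (triv_class R l) = 0.
  by move=> _ /eqP ne_m'l; rewrite charval_triv; case: eqP => // eq_l; case: ne_m'l.
have Res0 : Res (val q) (triv_class R l) = 0.
  apply: subM_charval_eq0 (Res_subM q Ml) _ => n' k c k0.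
  case: (leqP n' 2) => [n'_le2 | n'_gt2]; first exact: charval_small.
  rewrite charval_Res // charval_triv; case: eqP => // def_l.
  by move: n'_gt2; rewrite ltnNge l_min.
have := charval_comm_level (b := b) Ml triv_l qm_gt2 (fun _ => erefl 0%N).
rewrite mul0n dvdn0 div0n charval_triv eqxx mulr1 => <-.
have := charval_Res (val q) 0 b (op_act a (triv_class R l)) m_gt2.
by rewrite muln0 => <-; rewrite -[Res _ _]/(sym_op (GRes q) _) -a_comm //= Res0 !linear0.
Qed.

(** Level n is not reached by Ind_q, so Ind_q of anything has value 0 there; this
applies to a Ind_q = Ind_q a on the trivial module of level m. *)
Lemma transfer_coef_ind b n m (q : P) : in_level m -> (2 < n)%N ->
  (forall m', n = val q * m' -> m' <= 2)%N -> transfer_coef b (val q * m) n = 0.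
Proof.
case=> l [<- Ml] n_gt2 n_min.
have q_gt0 : (0 < val q)%N by rewrite prime_gt0 ?prime_natP.
have Ind_l (m' : nat) k (c : bool) : (c -> k = 0)%N -> m' != (val q * l)%N ->
    charval m' k c (Ind (val q) (triv_class R l)) = 0.
  move=> k0 ne_m'; rewrite charval_Ind ?odd_val //.
  case: ifP => // /andP[q_m' _]; rewrite charval_triv; case: eqP => [def_l|]; last by rewrite mulr0.
  by case/eqP: ne_m'; rewrite def_l mulnC divnK.
have := charval_comm_level (b := b) (Ind_subM q Ml) Ind_l n_gt2 (fun _ => erefl 0%N).
rewrite mul0n dvdn0 div0n charval_Ind ?odd_val // dvdn0 dvdn_mulr // mulKn //=.
rewrite div0n charval_triv eqxx mulr1.
rewrite -[Ind _ _]/(sym_op (GInd q) _) a_comm //= charval_Ind ?odd_val // dvdn0 andbT => eq0.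
apply: (mulIf (ind_coef_neq0 R b [:: q])).
rewrite mul0r prime_prod_cons /prime_prod big_nil muln1 -eq0.
case: ifP => // /dvdnP[c def_n]; rewrite def_n mulnK // charval_small ?mulr0 //.
by apply: n_min; rewrite mulnC.
Qed.

(** The reduced form s/t of x/n only involves primes of P when some word of a reads
level n at level x, since s r = t i for its two products. *)
Lemma transfer_coef_eq0 b n x : in_level n -> (2 < x)%N -> x <> n ->
  transfer_coef b n x = 0.
Proof.
move=> Nn x_gt2 ne_xn; have n_gt2 := in_level_gt2 Nn.
have [x_gt0 n_gt0] : (0 < x)%N /\ (0 < n)%N by split; apply: ltn_trans (isT : 0 < 2)%N _.
case: (pselect (exists w : seq (op_sym P),
  x * res_prod w = n * ind_prod w)%N); last first.
  by move=> no_w; apply: big1 => w /eqP eq_w; case: no_w; exists w.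
case=> w; set r := prime_prod _; set I := prime_prod _ => eq_rI.
pose d := gcdn x n; have d_gt0 : (0 < d)%N by rewrite gcdn_gt0 x_gt0.
have [s def_x] : exists s, x = (s * d)%N by apply/dvdnP/dvdn_gcdl.
have [t def_n] : exists t, n = (t * d)%N by apply/dvdnP/dvdn_gcdr.
have co_st : coprime s t.
  by rewrite /coprime -(eqn_pmul2r d_gt0) mul1n muln_gcdl -def_x -def_n.
have eq_sr : (s * r = t * I)%N.
  by apply/eqP; rewrite -(eqn_pmul2r d_gt0) mulnAC -def_x eq_rI def_n mulnAC.
have s_I : (s %| I)%N by rewrite -(Gauss_dvdr _ co_st) -eq_sr dvdn_mulr.
have t_r : (t %| r)%N.
  by rewrite -(@Gauss_dvdr t s) 1?coprime_sym // eq_sr dvdn_mulr.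
pose PS q := exists r : P, val r = q :> nat.
have smooth_dvd u (ps : seq P) : (u %| prime_prod ps)%N -> smooth_over PS u.
  move=> u_dv; split=> [|q q_pr q_u]; first exact: dvdn_gt0 (prime_prod_gt0 ps) u_dv.
  exact: prime_dvd_prime_prod q_pr (dvdn_trans q_u u_dv).
have s_sm := smooth_dvd _ _ s_I; have s_gt0 := s_sm.1.
have t_sm := smooth_dvd _ _ t_r; have t_gt0 := t_sm.1.
have s_odd : odd s by apply: dvdn_odd s_I (odd_prime_prod P_odd _).
have t_odd : odd t by apply: dvdn_odd t_r (odd_prime_prod P_odd _).
have separate s' t' q : coprime s' t' -> (q %| s')%N -> PS q ->
    smooth_over PS s' -> smooth_over PS t' -> odd t' ->
  exists n1 m, [/\ in_level n1, in_level m, (forall m', n1 = q * m' -> m' <= 2)%N &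
                   (q * m * t' = s' * n1)%N].
  move=> co q_s' PSq; apply: (separating_levels (PS := PS)) Nn PSq co q_s' => //.
  - exact: in_level_gt2.
  - by move=> n' _ [q' <-]; apply: in_level_mul.
  - by move=> n' _ [q' <-]; apply: in_level_div.
  - by move=> _ [q' <-]; apply: prime_natP.
case: (ltngtP s 1) => [|s_gt1|s1]; first by rewrite ltnNge s_gt0.
  have [q def_q] := s_sm.2 _ (pdiv_prime s_gt1) (pdiv_dvd s).
  have [|n1 [m [Nn1 Nm n1_min eq_m]]] :=
      separate _ _ _ co_st (pdiv_dvd s) _ s_sm t_sm t_odd.
    by exists q.
  rewrite -def_q in n1_min eq_m.
  rewrite (@transfer_coef_ratio b n x n1 (val q * m)) ?(ltn_trans _ (in_level_gt2 Nn1)) //.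
    exact: transfer_coef_res (in_level_gt2 Nm) n1_min.
  by rewrite def_x def_n mulnA eq_m mulnAC.
case: (ltngtP t 1) => [|t_gt1|t1]; first by rewrite ltnNge t_gt0.
  have [q def_q] := t_sm.2 _ (pdiv_prime t_gt1) (pdiv_dvd t).
  have [||n1 [m [Nn1 Nm n1_min eq_m]]] :=
      separate _ _ _ _ (pdiv_dvd t) _ t_sm s_sm s_odd.
  - by rewrite coprime_sym.
  - by exists q.
  rewrite -def_q in n1_min eq_m.
  rewrite (@transfer_coef_ratio b n x (val q * m) n1) //.
  - exact: transfer_coef_ind Nm (in_level_gt2 Nn1) n1_min.
  - by rewrite (ltn_trans _ (in_level_gt2 (in_level_mul q Nm))).
  - by rewrite def_x def_n mulnC mulnA eq_m [(t * n1)%N]mulnC -mulnA.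
by case: ne_xn; rewrite def_x def_n s1 t1.
Qed.

(** Since [transfer_coef b n n] depends on the ratio n/n only, it is the same scalar at
all levels, including those in different components of M. *)
Lemma charval_comm n k b v : v \inM -> (b -> k = 0%N) ->
  charval n k b (op_act a v) = transfer_coef b 1 1 * charval n k b v.
Proof.
move=> Mv k0; case: (leqP n 2) => [n_le2 | n_gt2].
  by rewrite !charval_small // mulr0.
rewrite [v]groth_decomp (linear_sum (op_act a)) !(linear_sum (charval n k b)) mulr_sumr.
apply: eq_big_seq => S.
rewrite -mcoeff_neq0 => /(subM_supp Mv)/simple_subM MS.
suff eqS : charval n k b (op_act a (simple_class S)) =
    transfer_coef b 1 1 * charval n k b (simple_class S).
  transitivity (charval n k b (v@_S *: op_act a (simple_class S))).
    by apply: (congr1 (charval n k b)); apply: linearZ_LR.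
  apply: etrans (charvalZ _ _ _ _ _) _; rewrite eqS mulrCA.
  by apply: (congr1 ( *%R _)); apply: esym (charvalZ _ _ _ _ _).
have NS := simple_in_level MS.
have l_gt0 := ltn_trans (isT : 0 < 2)%N (in_level_gt2 NS).
have n_gt0 : (0 < n)%N := ltn_trans (isT : 0 < 2)%N n_gt2.
rewrite (charval_comm_level (n := tag S)) //; last first.
  by move=> m k' c _ /eqP ne_m; rewrite charval_simple; case: eqP => // eq_m; case: ne_m.
case: (n =P tag S) => [def_n | ne_n].
  rewrite -def_n (dvdn_mull _ (dvdnn n)) (mulnK _ n_gt0).
  by rewrite (@transfer_coef_ratio b n n 1 1) // muln1 mul1n.
rewrite (transfer_coef_eq0 _ NS n_gt2 ne_n) mul0r if_same.
by rewrite charval_simple; case: eqP => [def_n | _]; [case: ne_n | rewrite mulr0].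
Qed.
End Commuting.

Lemma charval_ResInd (q : P) n k b v : (b -> k = 0%N) ->
  charval n k b (Res (val q) (Ind (val q) v)) = ind_coef R b (val q) * charval n k b v.
Proof.
move=> k0; case: (leqP n 2) => [n_le2 | n_gt2].
  by rewrite !charval_small // mulr0.
have q_gt0 : (0 < val q)%N by rewrite prime_gt0 // prime_natP.
rewrite charval_Res // charval_Ind ?odd_val //; last by move/k0->; rewrite muln0.
by rewrite !(dvdn_mulr _ (dvdnn _)) /= !(mulKn _ q_gt0).
Qed.

Lemma charval_sym (g : op_sym P) n k b : (b -> k = 0%N) ->
  exists c n' k', (b -> k' = 0%N) /\
    forall v, charval n k b (sym_op g v) = c * charval n' k' b v.
Proof.
move=> k0; case: (leqP n 2) => [n_le2 | n_gt2].
  by exists 0, 0%N, 0%N; split=> // v; rewrite !charval_small // mul0r.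
case: g => q.
  exists 1, (val q * n)%N, (val q * k)%N; split=> [/k0-> | v]; first by rewrite muln0.
  by rewrite mul1r -charval_Res.
exists (if (val q %| n)%N && (val q %| k)%N then if b then 1 else (val q)%:R else 0).
exists (n %/ val q)%N, (k %/ val q)%N; split=> [/k0-> | v]; first by rewrite div0n.
rewrite -[sym_op _ _]/(Ind (val q) v) charval_Ind ?odd_val //.
by case: (_ && _); rewrite ?mul0r.
Qed.

Lemma subM_sub u v : u \inM -> v \inM -> (v - u) \inM.
Proof. by move=> Mu Mv; rewrite addrC -scaleN1r; apply: subM_lin. Qed.

Lemma subM_charval_eq u v : u \inM -> v \inM ->
  (forall n k b, (b -> k = 0%N) -> charval n k b u = charval n k b v) -> u = v.
Proof.
move=> Mu Mv eq_uv; apply/eqP; rewrite -subr_eq0; apply/eqP.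
apply: subM_charval_eq0 (subM_sub Mv Mu) _ => n k b k0.
by rewrite (linearB (charval n k b)) /= eq_uv // subrr.
Qed.

(** Both sides multiply all values of the same type by the same factor, and every
generator carries values of one type to values of the same type. *)
Lemma ResInd_comm (q : P) (a : opalg R P) v : v \inM ->
  Res (val q) (Ind (val q) (op_act a v)) = op_act a (Res (val q) (Ind (val q) v)).
Proof.
move=> Mv; apply: (linear_op_act (h := @Res R (val q) \o @Ind R (val q))) => w /=.
have MRI u : u \inM -> Res (val q) (Ind (val q) u) \inM.
  by move=> Mu; apply/Res_subM/Ind_subM.
elim: w => //= g w IHw; rewrite -IHw.
have Mw := word_subM w Mv; apply: subM_charval_eq.
- exact/MRI/(word_subM [:: g] Mw).
- exact/(word_subM [:: g])/MRI.
move=> n k b k0; rewrite charval_ResInd //.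
have [c [n' [k' [k'0 symE]]]] := charval_sym g n k0.
by rewrite !symE charval_ResInd // mulrCA.
Qed.

(** The scalars lam true and lam false are interpolated by c + d e, where e is the
eigenvalue of Res_q Ind_q: 1 at reflections and q at rotations. *)
Lemma comm_ResInd_span (q : P) (a : opalg R P) :
    (forall (g : op_sym P) v, v \inM -> op_act a (sym_op g v) = sym_op g (op_act a v)) ->
  exists c d : C, forall v, v \inM ->
    op_act a v = op_act (c *: 1 + d *: (symRes R q * symInd R q)) v.
Proof.
move=> a_comm; pose lam b := transfer_coef a b 1 1.
have q1_neq0 : (val q)%:R - 1 != 0 :> C.
  by rewrite -[X in _ - X]/(1%:R) subr_eq0 eqr_nat gtn_eqF // prime_gt1 // prime_natP.
pose d := (lam false - lam true) / ((val q)%:R - 1).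
exists (lam true - d), d => v Mv.
rewrite op_act_linearl op_act1 op_actZl op_act_ResInd.
apply: subM_charval_eq; first exact: sub_act.
  apply: subM_lin => //; rewrite -[_ *: _]addr0.
  by apply: subM_lin subM0; apply/Res_subM/Ind_subM.
move=> n k b k0; rewrite (charval_comm a_comm) // charval_comb charval_ResInd // -/(lam b).
transitivity ((lam true - d + d * ind_coef R b (val q)) * charval n k b v); last first.
  by rewrite mulrDl -mulrA.
apply: (congr1 (fun e => e * charval n k b v)).
case: b {k0} => /=; first by rewrite mulr1 subrK.
by rewrite -addrA -mulrN1 -mulrDr addrC [- 1 + _]addrC divfK // subrK.
Qed.
End Module.

Local Open Scope classical_set_scope.

Theorem theorem29 (R : realType) (P : set prime_nat)
    (P_odd : forall q : prime_nat, P q -> odd q) (p : P)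
    (M : submodule R P)
    (M_span : exists2 B : set (simple_module R),
        (forall S : simple_module R, B S -> odd (tag S)) &
        sub_carrier M = lin_span [set simple_class S | S in B])
    (M_full : forall n : level,
        (forall S : simple_module R, tag S = n -> sub_carrier M (simple_class S)) \/
        (forall S : simple_module R, tag S = n -> ~ sub_carrier M (simple_class S))) :
  alg_center M = generated_subalgebra [set 1; quoRes M p * quoInd M p].
Proof.
case: M_span => B B_odd defM.
pose RI := symRes R p * symInd R p.
have RIE : quoRes M p * quoInd M p = toquo M RI by apply: toquoM.
have toquo_mul a c : toquo M a * toquo M c = toquo M (a * c) by apply: toquoM.
have toquo_scale c a : c *: toquo M a = toquo M (c *: a) by apply: toquoZ.
have toquo_surj x : exists a, x = toquo M a.
  by exists (generic_quotient.repr x); rewrite toquoK.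
have quo_scaleAl c (x z : quoalg M) : (c *: x) * z = c *: (x * z).
  have [[a ->] [e ->]] := (toquo_surj x, toquo_surj z).
  rewrite (toquo_scale c a) (toquo_mul (c *: a) e) (toquo_mul a e) (toquo_scale c (a * e)).
  by apply: (congr1 (toquo M)); apply/esym; apply: scalerAl.
have quo_scaleAr c (x z : quoalg M) : z * (c *: x) = c *: (z * x).
  have [[a ->] [e ->]] := (toquo_surj x, toquo_surj z).
  rewrite (toquo_scale c a) (toquo_mul e (c *: a)) (toquo_mul e a) (toquo_scale c (e * a)).
  by apply/toquoP/annP => v Mv; rewrite op_actBl op_act_scaler subrr.
apply/seteqP; split=> [z z_central | ]; last first.
  apply: smallest_sub => [|z [-> | ->] x]; first split.
  - by apply/mem_set => x; rewrite mul1r mulr1.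
  - move=> c x y /set_mem Cx /set_mem Cy; apply/mem_set => z.
    rewrite mulrDl mulrDr; apply: (congr2 +%R _ (Cy z)).
    exact: etrans (quo_scaleAl c x z) (etrans (congr1 _ (Cx z)) (esym (quo_scaleAr c x z))).
  - move=> x y /set_mem Cx /set_mem Cy; apply/mem_set => z.
    apply: etrans (esym (mulrA x y z)) _.
    apply: etrans (congr1 ( *%R x) (Cy z)) _.
    apply: etrans (mulrA x z y) _.
    apply: etrans (congr1 ( *%R^~ y) (Cx z)) _.
    exact: (esym (mulrA z x y)).
  - by rewrite mul1r mulr1.
  have [a ->] := toquo_surj x.
  rewrite RIE (toquo_mul RI a) (toquo_mul a RI); apply/toquoP/annP => v Mv.
  rewrite op_actBl; apply/eqP; rewrite subr_eq0; apply/eqP.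
  apply: etrans (op_actM RI a v) _; apply: etrans (op_act_ResInd p _) _.
  apply: etrans (ResInd_comm P_odd B_odd defM p a Mv) _.
  exact: esym (etrans (op_actM a RI v) (congr1 (op_act a) (op_act_ResInd p v))).
have [a def_z] := toquo_surj z.
have a_comm (g : op_sym P) v : sub_carrier M v ->
    op_act a (sym_op g v) = sym_op g (op_act a v).
  move=> Mv; have zg := z_central (toquo M << fmu g >>); rewrite def_z in zg.
  have /toquoP/annP/(_ v Mv)/eqP := etrans (esym (toquo_mul a _)) (etrans zg (toquo_mul _ a)).
  rewrite op_actBl subr_eq0 => /eqP agE.
  rewrite -(op_act_sym g v) -(op_act_sym g (op_act a v)).
  exact: etrans (esym (op_actM a _ v)) (etrans agE (op_actM _ a v)).
have [c [d aE]] := comm_ResInd_span P_odd B_odd defM M_full p a_comm.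
move=> S [[S1 S_lin S_mul] genS].
have S0 : (0 : quoalg M) \in S.
  by have := S_lin (-1) _ _ S1 S1; rewrite scaleN1r addNr; apply.
have S_RI : toquo M RI \in S by apply/mem_set/genS; right; apply: esym.
have SZ e x : x \in S -> e *: x \in S.
  by move=> Sx; rewrite -[e *: x]addr0; apply: S_lin.
apply: (eq_ind_r S (set_mem (S_lin c _ _ S1 (SZ d _ S_RI)))).
apply: etrans (etrans def_z _) (esym (congr2 +%R (toquo_scale c 1) (toquo_scale d RI))).
apply: etrans _ (toquoD _ _ _).
by apply/toquoP/annP => v Mv; rewrite op_actBl (aE v Mv) subrr.
Qed.
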